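(* Let $X_0\in\Gamma_1$ and let $(X_n)_{n\ge0}$ be the sequence produced by the iterative proportional fitting procedure started at $X_0$ with target marginals $a,b$. Assume that $\Gamma(a,b)$ contains no matrix with support included in $\mathrm{Supp}(X_0)$. Then there exist some positive integer $r\le\min(p,q)$, and partitions $\{I_1,\dots,I_r\}$ of $\{1,\dots,p\}$ and $\{J_1,\dots,J_r\}$ of $\{1,\dots,q\}$ such that, setting $\lambda_k=b(J_k)/a(I_k)$ for $k\in\{1,\dots,r\}$, and defining $a'=(a'_1,\dots,a'_p)$ and $b'=(b'_1,\dots,b'_q)$ by $a'_i/a_i=\lambda_k$ whenever $i\in I_k$ and $b'_j/b_j=\lambda_k^{-1}$ whenever $j\in J_k$: 1. $(R_i(X_{2n}))_{n\ge0}$ converges to $\lambda_k$ whenever $i\in I_k$; 2. $(C_j(X_{2n+1}))_{n\ge0}$ converges to $\lambda_k^{-1}$ whenever $j\in J_k$; 3. $X_n(i,j)=0$ for every $n\ge0$ whenever $i\in I_k$ and $j\in J_{k'}$ with $k<k'$; 4. $X_n(i,j)\to0$ as $n\to+\infty$ at a geometric rate whenever $i\in I_k$ and $j\in J_{k'}$ with $k>k'$; 5. the sequence $(X_{2n})_{n\ge0}$ converges to the unique matrix achieving the minimum of $D(Y\|X_0)$ over all $Y\in\Gamma(a',b,X_0)$; 6. the sequence $(X_{2n+1})_{n\ge0}$ converges to the unique matrix achieving the minimum of $D(Y\|X_0)$ over all $Y\in\Gamma(a,b',X_0)$; 7. for every $k\in\{1,\dots,r\}$, $a'(I_k)=b(J_k)$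 and $a(I_k)=b'(J_k)$; moreover, the support of any matrix in $\Gamma(a',b,X_0)\cup\Gamma(a,b',X_0)$ is contained in $I_1\times J_1\cup\dots\cup I_r\times J_r$; 8. let $D_1=\mathrm{Diag}(a'_1/a_1,\dots,a'_p/a_p)$ and $D_2=\mathrm{Diag}(b_1/b'_1,\dots,b_q/b'_q)$; then for every $S\in\Gamma(a,b',X_0)$, $D_1S=SD_2\in\Gamma(a',b,X_0)$, and all matrices in $\Gamma(a',b,X_0)$ can be written in this way.
   Context: Fix integers $p,q\ge 2$ and vectors $a=(a_1,\dots,a_p)$, $b=(b_1,\dots,b_q)$ with positive components such that $\sum_i a_i=\sum_j b_j=1$. For a vector $v$ and a set $K$ of indices, $v(K)=\sum_{i\in K}v_i$. For a $p\times q$ matrix $X$, set $X(i,+)=\sum_jX(i,j)$, $X(+,j)=\sum_iX(i,j)$, $X(+,+)=\sum_{i,j}X(i,j)$, $R_i(X)=X(i,+)/a_i$, $C_j(X)=X(+,j)/b_j$. $\Gamma_0$ is the set of non-negative $p\times q$ matrices all of whose row sums and column sums are positive; $\Gamma_1=\{X\in\Gamma_0:X(+,+)=1\}$. $\mathrm{Supp}(X)=\{(i,j):X(i,j)>0\}$. For vectors $\alpha,\beta$ with positive components, $\Gamma(\alpha,\beta)$ is the set of $X\in\Gamma_0$ with $X(i,+)=\alpha_i$ for all $i$ and $X(+,j)=\beta_j$ for all $j$, and $\Gamma(\alpha,\beta,X_0)=\{S\in\Gamma(\alpha,\beta):\mathrm{Supp}(S)\subset\mathrm{Supp}(X_0)\}$.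 Parts of a partition are non-empty. $\mathrm{Diag}(d_1,\dots,d_m)$ is the diagonal matrix with diagonal entries $d_1,\dots,d_m$. Iterative proportional fitting procedure (IPFP): for $X\in\Gamma_0$ let $T_R(X)(i,j)=X(i,j)/R_i(X)$ and $T_C(X)(i,j)=X(i,j)/C_j(X)$; then $X_{2n+1}=T_R(X_{2n})$ and $X_{2n+2}=T_C(X_{2n+1})$ for all $n\ge0$. Relative entropy: for $X,Y\in\Gamma_1$, $D(Y\|X)=\sum_{(i,j)\in\mathrm{Supp}(X)}Y(i,j)\ln\frac{Y(i,j)}{X(i,j)}$ if $\mathrm{Supp}(Y)\subset\mathrm{Supp}(X)$ (with $0\ln0=0$), and $D(Y\|X)=+\infty$ otherwise. A sequence $(x_n)$ converging to $x_\infty$ in a normed vector space converges at a geometric rate if $0<\lim_n\|x_n-x_\infty\|^{1/n}<1$.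
   Formalization: In item 4, X_n(i,j)→0 is proved for all such (i,j), but the geometric rate only when X_0(i,j)>0; if X_0(i,j)=0 then X_n(i,j)=0 for all n and the limit of |X_n(i,j)|^{1/n} is 0, so the rate as defined fails. *)

(* Defs.v *)
From HB Require Import structures.
From mathcomp Require Import all_boot all_order all_algebra.
From mathcomp Require Import all_classical all_reals all_analysis.

Set Implicit Arguments.
Unset Strict Implicit.
Unset Printing Implicit Defensive.

Import Order.TTheory GRing.Theory Num.Theory.
Import numFieldNormedType.Exports.

Local Open Scope classical_set_scope.
Local Open Scope ring_scope.

Section Ipfp.
Context {R : realType} {p q : nat}.
Implicit Types (a alpha : 'rV[R]_p) (b beta : 'rV[R]_q) (X Y : 'M[R]_(p, q)).

Definition row_sum X (i : 'I_p) : R := \sum_(j < q) X i j.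
Definition col_sum X (j : 'I_q) : R := \sum_(i < p) X i j.
Definition total_sum X : R := \sum_(i < p) \sum_(j < q) X i j.

Definition row_ratio a X (i : 'I_p) : R := row_sum X i / a ord0 i.
Definition col_ratio b X (j : 'I_q) : R := col_sum X j / b ord0 j.

Definition Supp X : {set 'I_p * 'I_q} := [set ij | 0 < X ij.1 ij.2]%SET.

Definition Gamma0 :=
  [set X : 'M[R]_(p, q) |
    [/\ forall i j, 0 <= X i j,
        forall i, 0 < row_sum X i &
        forall j, 0 < col_sum X j]].

Definition Gamma1 :=
  [set X : 'M[R]_(p, q) | Gamma0 X /\ total_sum X = 1].

Definition Gamma alpha beta :=
  [set X : 'M[R]_(p, q) |
    [/\ Gamma0 X,
        forall i, row_sum X i = alpha ord0 i &
        forall j, col_sum X j = beta ord0 j]].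

Definition Gamma_in alpha beta X :=
  [set Y : 'M[R]_(p, q) | Gamma alpha beta Y /\ Supp Y \subset Supp X].

Definition T_R a X : 'M[R]_(p, q) := \matrix_(i, j) (X i j / row_ratio a X i).
Definition T_C b X : 'M[R]_(p, q) := \matrix_(i, j) (X i j / col_ratio b X j).

Fixpoint ipfp a b X (n : nat) : 'M[R]_(p, q) :=
  if n is m.+1 then
    if odd m then T_C b (ipfp a b X m) else T_R a (ipfp a b X m)
  else X.

(* rel_entropy Y X is D(Y || X).  Since ln 0 = 0 in the library, terms with
   Y i j = 0 vanish, as required by the convention 0 ln 0 = 0. *)
Definition rel_entropy Y X : \bar R :=
  if Supp Y \subset Supp X then
    (\sum_(ij in Supp X) Y ij.1 ij.2 * ln (Y ij.1 ij.2 / X ij.1 ij.2))%:E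
  else +oo%E.

End Ipfp.

Definition vsum {R : realType} {m : nat} (v : 'rV[R]_m) (K : {set 'I_m}) : R :=
  \sum_(i in K) v ord0 i.

(* A partition of T into exactly r parts, listed as I_0, ..., I_(r-1);
   the library's [partition] already requires the parts to be non-empty. *)
Definition is_indexed_partition {T : finType} {r : nat} (I : 'I_r -> {set T}) :=
  injective I /\ finset.partition [set I k | k : 'I_r]%SET [set: T]%SET.

Definition unique_minimizer {R : realType} {T : Type} (f : T -> \bar R)
    (A : set T) (y : T) :=
  [/\ A y,
      forall z, A z -> (f y <= f z)%E &
      forall y', A y' -> (forall z, A z -> (f y' <= f z)%E) -> y' = y].

(* The term at n = 0, where n%:R^-1 = 0, does not affect the limit. *)
Definition cvg_geometrically {R : realType} {V : normedModType R}
    (x : nat -> V) (l : V) :=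
  x n @[n --> \oo] --> l /\
  exists c : R, [/\ 0 < c, c < 1 &
    (`|x n - l| `^ (n%:R^-1))%R @[n --> \oo] --> c].

(* Main.v *)
Require Import Defs.
From HB Require Import structures.
From mathcomp Require Import all_boot all_order all_algebra.
From mathcomp Require Import all_classical all_reals all_analysis.
From mathcomp Require Import ring lra.

Set Implicit Arguments.
Unset Strict Implicit.
Unset Printing Implicit Defensive.

Import Order.TTheory GRing.Theory Num.Theory.
Import numFieldNormedType.Exports.

Local Open Scope classical_set_scope.
Local Open Scope ring_scope.

(** Write [rho n i] for the row ratios of [X n.*2] and [gam n j] for the column
    ratios of [X n.*2.+1].

    Each half-step minimises a relative entropy, and the two half-steps
    approximate the matrices with row sums [a] by those with column sums [b] and
    conversely, in the manner of alternating projections (Csiszar and Tusnady).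
    Consequently [\sum_i a_i ln (rho n i)] is non-decreasing
    ([Phi_add_Psi_le0], [opp_Psi_le_Phi]), and for every cluster point [Z] of the
    odd terms the entropy of [Z] relative to [X n.*2.+1] is non-increasing
    ([kl_half_le]).  As it tends to 0 along the cluster, it tends to 0, and the
    Hellinger bound [kl_ge_hellinger] shows that the odd terms converge to [Z];
    the even ones then converge to a matrix [Y], with [Z = T_R Y] and
    [Y = T_C Z] ([alternating_scaling_cvg]).

    Let [rho] and [gam] be the limit ratios.  Since [Y = T_C (T_R Y)], the
    support of [Y] is contained in the set where [rho i * gam j = 1]
    ([limit_supp]); and where [X0 i j] is positive, [rho i * gam j] is at least
    1, for otherwise [X n.*2 i j] would stay away from 0 ([rho_gam_ge1]).  The
    sets [I_k] and [J_k] are the level sets of [rho] and of [1 / gam], listed by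
    increasing level [l k].  Counting the mass of [Y] in a block by rows and by
    columns gives [l k = b(J_k) / a(I_k)] ([block_mass]), and the two facts
    above give the triangular shape of the support of [X0].  Entries strictly
    below the blocks are multiplied over two steps by a factor that tends to
    [(rho i * gam j)^-1 < 1], hence the geometric rate.

    All [X n] are obtained from [X0] by scaling rows and columns, which changes
    the entropy of every matrix of [Gamma_in alpha beta X0] by the same amount;
    hence the limits minimise the entropy relative to [X0]
    ([kl_scaled_limit]).  Finally, the sum of [S i j * (rho i - 1 / gam j)]
    depends on the marginals of [S] only; it vanishes for [Y] and for [Z], while
    its terms are non-negative when [S] is supported in the support of [X0]: this
    confines all competitors to the blocks ([supp_same_marginals]), where
    scaling the rows by [rho] amounts to scaling the columns by [1 / gam]. *)

(** * Limits of sequences and of matrices *)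

Lemma cvg_sum (R : realType) (T : Type) (F : set_system T) (I : finType)
    (f : I -> T -> R) (l : I -> R) :
  Filter F -> (forall i, f i n @[n --> F] --> l i) ->
  \sum_i f i n @[n --> F] --> \sum_i l i.
Proof. by move=> FF fl; apply: cvg_big => // x; exact: add_continuous. Qed.

Lemma cvg_mx (R : realType) (T : Type) (F : set_system T) (p q : nat)
    (X : T -> 'M[R]_(p, q)) (Y : 'M[R]_(p, q)) :
  Filter F -> (forall i j, X n i j @[n --> F] --> Y i j) ->
  X n @[n --> F] --> Y.
Proof.
move=> FF XY A [B YB BA].
have : \forall n \near F, forall ij : 'I_p * 'I_q, B ij.1 ij.2 (X n ij.1 ij.2).
  by apply: filter_forall => -[i j]; apply: XY; exact: YB.
by apply: filterS => n Bn; apply: BA => i j; exact: (Bn (i, j)).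
Qed.

Lemma nbhs_infty_half (P : set nat) :
  (\forall n \near \oo, P n) -> \forall n \near \oo, P n./2.
Proof.
move=> [N _ NP]; exists N.*2 => // n /= Nn; apply: NP => /=.
by rewrite -(doubleK N); exact: half_leq.
Qed.

Lemma cvg_even_odd (T : topologicalType) (u : nat -> T) (l : T) :
  u n.*2 @[n --> \oo] --> l -> u n.*2.+1 @[n --> \oo] --> l ->
  u n @[n --> \oo] --> l.
Proof.
move=> ue uo A lA.
have Ae : \forall n \near \oo, A (u n./2.*2) := nbhs_infty_half (ue A lA).
have Ao : \forall n \near \oo, A (u n./2.*2.+1) := nbhs_infty_half (uo A lA).
suff : \forall n \near \oo, A (u n) by [].
near=> n; rewrite -(odd_double_half n); case: (odd n).
  by rewrite add1n; near: n.
by rewrite add0n; near: n.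
Unshelve. all: by end_near. Qed.

Lemma cvg_unsucc (T : ptopologicalType) (u : nat -> T) (l : T) :
  u n.+1 @[n --> \oo] --> l -> u n @[n --> \oo] --> l.
Proof. by rewrite -[X in _ -> X]cvg_shiftS. Qed.

Lemma eq_cvg_to (R : realType) (T : Type) (F : set_system T) (f g : T -> R)
    (k l : R) :
  f n @[n --> F] --> k -> f =1 g -> k = l -> g n @[n --> F] --> l.
Proof. by move=> fk /funext <- <-. Qed.

Lemma cvg_ln (R : realType) (T : Type) (F : set_system T) (f : T -> R) (l : R) :
  Filter F -> 0 < l -> f n @[n --> F] --> l ->
  ln (f n) @[n --> F] --> ln l.
Proof.
by move=> FF l0 fl; exact: (continuous_cvg FF (continuous_ln l0) fl).
Qed.

Lemma cvg_div (R : realType) (T : Type) (F : set_system T) (f g : T -> R)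
    (x y : R) :
  Filter F -> y != 0 -> f n @[n --> F] --> x -> g n @[n --> F] --> y ->
  f n / g n @[n --> F] --> x / y.
Proof. by move=> FF y0 fx gy; apply: cvgM => //; exact: cvgV. Qed.

(** A limit along an ultrafilter exists for every bounded family, so that
    finitely many bounded sequences have a common limit without any extraction
    of subsequences. *)
Lemma ultra_cvg_bounded (R : realType) (T : Type) (G : set_system T)
    (f : T -> R) (x y : R) :
  UltraFilter G -> (forall n, x <= f n <= y) ->
  exists l : R, f n @[n --> G] --> l.
Proof.
move=> GU fxy.
have GP : ProperFilter G by exact: ultra_proper.
have FU : UltraFilter (fmap f G).
  split; first exact: fmap_proper_filter.
  move=> H HP GH; apply/seteqP; split=> [A HA|]; last exact: GH.
  have [//|GnA] := in_ultra_setVsetC (f @^-1` A) GU.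
  have : H (~` A) by apply: GH.
  move=> HnA; have := filterI HA HnA; rewrite setICr => H0.
  by case: (@filter_not_empty _ H HP (H0 _)).
have := @segment_compact R x y; rewrite compact_ultra => /(_ _ FU).
case=> [|l [_ fl]]; last by exists l.
by rewrite /= /nbhs /=; apply: filterE => n /=; rewrite in_itv /= fxy.
Qed.

(** The unknown rate is read off the logarithms: [ln (x n) / n] is the mean of
    the increments of [ln (x n)].  When the successive ratios of [x] converge
    separately along even and odd indices, those increments do not converge;
    shifting the odd terms of [ln (x n)] by a suitable constant makes them
    converge and does not change the limit of the means. *)
Lemma cvg_ln_div_n (R : realType) (x : nat -> R) (s t : R) :
  (forall n, 0 < x n) -> 0 < s -> 0 < t ->
  x n.*2.+1 / x n.*2 @[n --> \oo] --> s ->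
  x n.*2.+2 / x n.*2.+1 @[n --> \oo] --> t ->
  ln (x n) / n%:R @[n --> \oo] --> (ln s + ln t) / 2.
Proof.
move=> x0 s0 t0 xs xt.
pose k := (ln t - ln s) / 2.
pose y n := ln (x n) + (if odd n then k else 0).
have dy : y n.+1 - y n @[n --> \oo] --> (ln s + ln t) / 2.
  apply: cvg_even_odd.
    have -> : (fun n => y n.*2.+1 - y n.*2) =
              (fun n => ln (x n.*2.+1 / x n.*2) + k).
      apply/funext => n; rewrite /y /= odd_double /= ln_div ?posrE ?x0 //.
      by rewrite addr0 addrAC.
    have -> : (ln s + ln t) / 2 = ln s + k by rewrite /k; field.
    by apply: cvgD (cvg_cst _); exact: cvg_ln.
  have -> : (fun n => y n.*2.+2 - y n.*2.+1) =
            (fun n => ln (x n.*2.+2 / x n.*2.+1) - k).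
    apply/funext => n; rewrite /y /= odd_double /= ln_div ?posrE ?x0 //.
    by rewrite addr0 opprD addrA.
  have -> : (ln s + ln t) / 2 = ln t - k by rewrite /k; field.
  by apply: cvgB (cvg_cst _); exact: cvg_ln.
have inv0 : (n.+1%:R^-1 : R) @[n --> \oo] --> 0 by exact: cvg_harmonic.
apply: cvg_unsucc.
have -> : (fun n => ln (x n.+1) / n.+1%:R) = (fun n =>
   arithmetic_mean (fun n => y n.+1 - y n) n +
   (y 0%N - (if odd n.+1 then k else 0)) * n.+1%:R^-1).
  apply/funext => n; rewrite /arithmetic_mean /series /= telescope_sumr //.
  by rewrite [X in X + _]mulrC -mulrDl; congr (_ * _); rewrite /y /=; ring.
rewrite -[X in _ --> X]addr0; apply: cvgD; first exact: cesaro.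
apply/norm_cvg0P.
apply: (@squeeze_cvgr _ _ _ _ (fun=> 0)
   (fun n => (`|y 0%N| + `|k|) * n.+1%:R^-1)).
- apply: filterE => n; rewrite normr_ge0 /= normrM.
  rewrite [X in _ * X]ger0_norm ?invr_ge0 //.
  rewrite ler_wpM2r ?invr_ge0 // (le_trans (ler_normB _ _)) // lerD2l.
  by case: ifP; rewrite // normr0.
- exact: cvg_cst.
- by rewrite -[X in _ --> X](mulr0 (`|y 0%N| + `|k|)); exact: cvgMl_tmp.
Qed.

(** * Relative entropy and Hellinger distance *)

Lemma ln_le_sub1 (R : realType) (x : R) : 0 < x -> ln x <= x - 1.
Proof.
by move=> x0; rewrite -{1}(subrK 1 x) addrC le_ln1Dx // ltrBrDr addrC subrr.
Qed.

(** This lower bound is summable to a distance between matrices.  For [x > 0],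
    apply [ln u <= u - 1] to [u = sqrt (y / x)]. *)
Lemma entropy_ge_sqrt (R : realType) (x y : R) :
  0 <= x -> 0 <= y -> (0 < x -> 0 < y) ->
  (Num.sqrt x - Num.sqrt y) ^+ 2 <= x * ln (x / y) - x + y.
Proof.
move=> x_ge0 y_ge0 xy.
have [x0|] := ltP 0 x; last first.
  move=> xle; have -> : x = 0 by apply/eqP; rewrite eq_le xle.
  by rewrite sqrtr0 sub0r sqrrN sqr_sqrtr // mul0r subr0 add0r.
have y0 := xy x0.
set s := Num.sqrt x; set t := Num.sqrt y.
have s0 : 0 < s by rewrite sqrtr_gt0.
have t0 : 0 < t by rewrite sqrtr_gt0.
have ts : 0 < t / s by rewrite divr_gt0.
have -> : x = s ^+ 2 by rewrite sqr_sqrtr.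
have -> : y = t ^+ 2 by rewrite sqr_sqrtr.
rewrite -expr_div_n lnXn ?divr_gt0 //.
have -> : ln (s / t) = - ln (t / s) by rewrite -lnV ?posrE // invf_div.
have := ln_le_sub1 ts; rewrite -(ler_pM2l (exprn_gt0 2 s0)).
have -> : s ^+ 2 * (t / s - 1) = s * t - s ^+ 2 by field; rewrite gt_eqF.
by rewrite mulr2n => h; nra.
Qed.

Section Entropy.
Context {R : realType} {p q : nat}.
Implicit Types A B : 'M[R]_(p, q).

Definition kl A B : R := \sum_i \sum_j A i j * ln (A i j / B i j).

Definition hellinger A B : R :=
  \sum_i \sum_j (Num.sqrt (A i j) - Num.sqrt (B i j)) ^+ 2.

Lemma hellinger_ge A B i j :
  (Num.sqrt (A i j) - Num.sqrt (B i j)) ^+ 2 <= hellinger A B.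
Proof.
rewrite /hellinger (bigD1 i) //= (bigD1 j) //= -!addrA lerDl.
by rewrite addr_ge0 // !sumr_ge0 // => *; rewrite ?sumr_ge0 // => *;
   exact: sqr_ge0.
Qed.

Lemma hellinger_ge0 A B : 0 <= hellinger A B.
Proof. by apply: sumr_ge0 => i _; apply: sumr_ge0 => j _; exact: sqr_ge0. Qed.

Lemma hellinger_le0 A B : (forall i j, 0 <= A i j) -> (forall i j, 0 <= B i j) ->
  hellinger A B <= 0 -> A = B.
Proof.
move=> A0 B0 h; apply/matrixP => i j.
have := le_trans (hellinger_ge A B i j) h.
rewrite le_eqVlt ltNge sqr_ge0 orbF sqrf_eq0 subr_eq0 => /eqP sAB.
by rewrite -(sqr_sqrtr (A0 i j)) sAB sqr_sqrtr.
Qed.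

Lemma kl_ge_hellinger A B :
  (forall i j, 0 <= A i j) -> (forall i j, 0 <= B i j) ->
  (forall i j, 0 < A i j -> 0 < B i j) -> total_sum A = total_sum B ->
  hellinger A B <= kl A B.
Proof.
move=> A0 B0 AB tAB.
have -> : kl A B =
    \sum_i \sum_j (A i j * ln (A i j / B i j) - A i j + B i j).
  rewrite /kl -[LHS](addrK (total_sum A)) {1}tAB addrAC /total_sum -sumrB -big_split /=.
  by apply: eq_bigr => i _; rewrite -sumrB -big_split.
by apply: ler_sum => i _; apply: ler_sum => j _;
   apply: entropy_ge_sqrt => //; exact: AB.
Qed.

Lemma cvg_kl (T : Type) (F : set_system T) A (Z : T -> 'M[R]_(p, q)) :
  Filter F -> (forall i j, 0 <= A i j) ->
  (forall i j, Z n i j @[n --> F] --> A i j) ->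
  kl A (Z n) @[n --> F] --> 0.
Proof.
move=> FF A0 ZA.
have -> : 0 = \sum_(i < p) \sum_(j < q) (0 : R).
  by rewrite big1 // => i _; rewrite big1.
apply: cvg_sum => i; apply: cvg_sum => j.
have [->|An0] := eqVneq (A i j) 0.
  by under eq_fun do rewrite mul0r; exact: cvg_cst.
have -> : 0 = A i j * ln (A i j / A i j) by rewrite divff // ln1 mulr0.
apply: cvgMl_tmp; apply: cvg_ln; first by rewrite divff.
by apply: cvg_div => //; exact: cvg_cst.
Qed.

Lemma cvg_of_hellinger (T : Type) (F : set_system T) A (Z : T -> 'M[R]_(p, q)) :
  Filter F -> (forall i j, 0 <= A i j) -> (forall n i j, 0 <= Z n i j) ->
  hellinger A (Z n) @[n --> F] --> 0 ->
  forall i j, Z n i j @[n --> F] --> A i j.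
Proof.
move=> FF A0 Z0 hZ i j.
have sq0 : (Num.sqrt (A i j) - Num.sqrt (Z n i j)) ^+ 2 @[n --> F] --> 0.
  apply: (@squeeze_cvgr _ _ _ _ (fun=> 0) (fun n => hellinger A (Z n))) => //.
    by apply: filterE => n; rewrite sqr_ge0 /= hellinger_ge.
  exact: cvg_cst.
have d0 : Num.sqrt (A i j) - Num.sqrt (Z n i j) @[n --> F] --> 0.
  apply/norm_cvg0P; apply: (eq_cvg_to
    (continuous_cvg FF (@sqrt_continuous R _) sq0)) => [n|] /=.
    by rewrite sqrtr_sqr.
  exact: sqrtr0.
have sZ : Num.sqrt (Z n i j) @[n --> F] --> Num.sqrt (A i j).
  apply: eq_cvg_to (cvgB (cvg_cst (Num.sqrt (A i j))) d0) _ _ => [n|].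
    by rewrite !fctE /= opprB addrCA subrr addr0.
  exact: subr0.
apply: eq_cvg_to (cvgM sZ sZ) _ _ => [n|] /=; by rewrite -expr2 sqr_sqrtr.
Qed.

End Entropy.

(** * Rows, columns and scalings *)

Section Scaling.
Context {R : realType} {p q : nat}.
Implicit Types (W S B X : 'M[R]_(p, q)) (u : 'I_p -> R) (v : 'I_q -> R).

Lemma total_sum_col X : total_sum X = \sum_j col_sum X j.
Proof. exact: exchange_big. Qed.

Lemma sum_scale W u v :
  \sum_i \sum_j W i j * (u i + v j) =
  \sum_i row_sum W i * u i + \sum_j col_sum W j * v j.
Proof.
under eq_bigr do under eq_bigr do rewrite mulrDr.
under eq_bigr do rewrite big_split /=.
rewrite big_split /=; congr (_ + _); first by
  apply: eq_bigr => i _; rewrite -mulr_suml.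
by rewrite exchange_big /=; apply: eq_bigr => j _; rewrite -mulr_suml.
Qed.

(** Jensen's inequality for the concave function [ln] and the probability [W],
    in the form given by [ln x <= x - 1]. *)
Lemma jensen_ln_scale W u v :
  (forall i j, 0 <= W i j) -> (forall i, 0 < u i) -> (forall j, 0 < v j) ->
  total_sum W = 1 -> \sum_i \sum_j W i j * (u i * v j) = 1 ->
  \sum_i row_sum W i * ln (u i) + \sum_j col_sum W j * ln (v j) <= 0.
Proof.
move=> W0 u0 v0 W1 Wuv; rewrite -sum_scale.
have s0 : \sum_i \sum_j (W i j * (u i * v j) - W i j) = 0.
  under eq_bigr do rewrite sumrB.
  by rewrite sumrB Wuv -/(total_sum W) W1 subrr.
rewrite -[leRHS]s0.
apply: ler_sum => i _; apply: ler_sum => j _.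
rewrite -lnM ?posrE // -[X in _ - X]mulr1 -mulrBr ler_wpM2l //.
by rewrite ln_le_sub1 // mulr_gt0.
Qed.

(** Scaling the rows and columns of the reference matrix changes the entropy of
    [S] by an amount that depends on the marginals of [S] only. *)
Lemma kl_scale S B B' u v :
  (forall i j, 0 <= S i j) -> (forall i j, 0 < S i j -> 0 < B i j) ->
  (forall i, 0 < u i) -> (forall j, 0 < v j) ->
  (forall i j, B' i j = B i j * (u i * v j)) ->
  kl S B = kl S B' +
    (\sum_i row_sum S i * ln (u i) + \sum_j col_sum S j * ln (v j)).
Proof.
move=> S0 SB u0 v0 B'E; rewrite -sum_scale /kl -big_split /=.
apply: eq_bigr => i _; rewrite -big_split /=; apply: eq_bigr => j _.
have [Sp|] := ltP 0 (S i j); last first.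
  by move=> Sn; have -> : S i j = 0 by [apply/eqP; rewrite eq_le Sn S0];
     rewrite !mul0r addr0.
have Bp := SB _ _ Sp; have uv0 : 0 < u i * v j by rewrite mulr_gt0.
rewrite B'E -mulrDr -lnM ?posrE // !ln_div ?lnM ?posrE ?mulr_gt0 //; ring.
Qed.

Lemma sum_scale_gt0 (I : finType) (f c : I -> R) :
  (forall i, 0 <= f i) -> (forall i, 0 < c i) -> 0 < \sum_i f i ->
  0 < \sum_i f i * c i.
Proof.
move=> f0 c0 sf; rewrite lt_def sumr_ge0 ?andbT => [|i _]; last first.
  by rewrite mulr_ge0 // ltW.
apply: contraTneq sf => /psumr_eq0P h.
rewrite big1 ?ltxx // => i _.
have /eqP := h (fun i _ => mulr_ge0 (f0 i) (ltW (c0 i))) i isT.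
by rewrite mulf_eq0 (gt_eqF (c0 i)) orbF => /eqP.
Qed.

End Scaling.

Section OneStep.
Context {R : realType}.

Lemma Gamma0_tr p q (X : 'M[R]_(p, q)) : Gamma0 X -> Gamma0 X^T.
Proof.
have rE (Y : 'M[R]_(q, p)) i : row_sum Y i = col_sum Y^T i.
  by apply: eq_bigr => j _; rewrite mxE.
have cE (Y : 'M[R]_(q, p)) j : col_sum Y j = row_sum Y^T j.
  by apply: eq_bigr => i _; rewrite mxE.
by case=> X0 Xr Xc; split=> [i j|i|j]; rewrite ?mxE ?rE ?cE ?trmxK.
Qed.

(** The two half-steps are exchanged by transposition, so that every property
    of [T_R] has a mirror image for [T_C]. *)
Lemma T_C_tr p q (b : 'rV[R]_q) (X : 'M[R]_(p, q)) : T_C b X = (T_R b X^T)^T.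
Proof.
apply/matrixP => i j; rewrite !mxE; congr (_ / (_ / _)).
by apply: eq_bigr => k _; rewrite mxE.
Qed.

Lemma row_sum_tr p q (X : 'M[R]_(p, q)) j : row_sum X^T j = col_sum X j.
Proof. by apply: eq_bigr => i _; rewrite mxE. Qed.

Lemma col_sum_tr p q (X : 'M[R]_(p, q)) i : col_sum X^T i = row_sum X i.
Proof. by apply: eq_bigr => j _; rewrite mxE. Qed.

Lemma row_ratio_gt0 p q (a : 'rV[R]_p) (X : 'M[R]_(p, q)) i :
  (forall i, 0 < a ord0 i) -> Gamma0 X -> 0 < row_ratio a X i.
Proof. by move=> a0 [_ Xr _]; rewrite divr_gt0. Qed.

Lemma col_ratio_gt0 p q (b : 'rV[R]_q) (X : 'M[R]_(p, q)) j :
  (forall j, 0 < b ord0 j) -> Gamma0 X -> 0 < col_ratio b X j.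
Proof. by move=> b0 [_ _ Xc]; rewrite divr_gt0. Qed.

Lemma row_sum_T_R p q (a : 'rV[R]_p) (X : 'M[R]_(p, q)) i :
  (forall i, 0 < row_sum X i) -> row_sum (T_R a X) i = a ord0 i.
Proof.
move=> X0; rewrite /row_sum; under eq_bigr do rewrite mxE.
rewrite -mulr_suml -/(row_sum X i) /row_ratio invf_div mulrC divfK //.
by rewrite gt_eqF.
Qed.

Lemma Gamma0_T_R p q (a : 'rV[R]_p) (X : 'M[R]_(p, q)) :
  (forall i, 0 < a ord0 i) -> Gamma0 X -> Gamma0 (T_R a X).
Proof.
move=> a0 [X0 Xr Xc]; split=> [i j|i|j].
- by rewrite mxE divr_ge0 // ltW // row_ratio_gt0.
- by rewrite row_sum_T_R.
- rewrite /col_sum; under eq_bigr do rewrite mxE.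
  by apply: sum_scale_gt0 => // [i|]; rewrite ?Xc // invr_gt0 row_ratio_gt0.
Qed.

Lemma col_sum_T_C p q (b : 'rV[R]_q) (X : 'M[R]_(p, q)) j :
  (forall j, 0 < col_sum X j) -> col_sum (T_C b X) j = b ord0 j.
Proof.
by move=> X0; rewrite T_C_tr col_sum_tr row_sum_T_R // => k; rewrite row_sum_tr.
Qed.

Lemma Gamma0_T_C p q (b : 'rV[R]_q) (X : 'M[R]_(p, q)) :
  (forall j, 0 < b ord0 j) -> Gamma0 X -> Gamma0 (T_C b X).
Proof.
by move=> b0 G; rewrite T_C_tr; apply/Gamma0_tr/Gamma0_T_R => //; exact: Gamma0_tr.
Qed.

(** Each new column ratio is an average of the inverses of the old row ratios,
    with weights [X i j / b j]. *)
Lemma col_ratio_T_R_bounds p q (a : 'rV[R]_p) (b : 'rV[R]_q) (X : 'M[R]_(p, q))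
    (m M : R) :
  (forall j, 0 < b ord0 j) -> (forall i j, 0 <= X i j) ->
  (forall j, col_sum X j = b ord0 j) -> 0 < m ->
  (forall i, m <= row_ratio a X i <= M) ->
  forall j, M^-1 <= col_ratio b (T_R a X) j <= m^-1.
Proof.
move=> b0 X0 Xb m0 mM j.
have cE : col_sum (T_R a X) j = \sum_i X i j * (row_ratio a X i)^-1.
  by apply: eq_bigr => i _; rewrite mxE.
have r0 i : 0 < row_ratio a X i by case/andP: (mM i) => /(lt_le_trans m0).
have const c : \sum_i X i j * c = c * b ord0 j by rewrite -mulr_suml -Xb mulrC.
rewrite ler_pdivlMr // ler_pdivrMr // cE -!const; apply/andP; split;
  apply: ler_sum => i _; rewrite ler_wpM2l // lef_pV2 ?posrE //.
all: have /andP[mr rM] := mM i => //.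
exact: lt_le_trans rM.
Qed.

Lemma row_ratio_T_C_bounds p q (a : 'rV[R]_p) (b : 'rV[R]_q) (X : 'M[R]_(p, q))
    (m M : R) :
  (forall i, 0 < a ord0 i) -> (forall i j, 0 <= X i j) ->
  (forall i, row_sum X i = a ord0 i) -> 0 < m ->
  (forall j, m <= col_ratio b X j <= M) ->
  forall i, M^-1 <= row_ratio a (T_C b X) i <= m^-1.
Proof.
move=> a0 X0 Xa m0 mM i.
have : M^-1 <= col_ratio a (T_R b X^T) i <= m^-1.
  apply: col_ratio_T_R_bounds => // [k l|k|k].
  - by rewrite mxE.
  - by rewrite col_sum_tr.
  - by rewrite /row_ratio row_sum_tr; exact: mM.
by rewrite /col_ratio -row_sum_tr -T_C_tr.
Qed.

End OneStep.

(** * Continuity of the half-steps *)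

Section Continuity.
Context {R : realType} {p q : nat} (T : Type) (F : set_system T).
Context {FF : Filter F} (X : T -> 'M[R]_(p, q)) (Y : 'M[R]_(p, q)).
Hypothesis XY : forall i j, X n i j @[n --> F] --> Y i j.

Lemma cvg_row_ratio (a : 'rV[R]_p) i :
  row_ratio a (X n) i @[n --> F] --> row_ratio a Y i.
Proof. by apply: cvgMr_tmp; apply: cvg_sum => j. Qed.

Lemma cvg_col_ratio (b : 'rV[R]_q) j :
  col_ratio b (X n) j @[n --> F] --> col_ratio b Y j.
Proof. by apply: cvgMr_tmp; apply: cvg_sum => i. Qed.

Lemma cvg_T_R (a : 'rV[R]_p) i j : row_ratio a Y i != 0 ->
  T_R a (X n) i j @[n --> F] --> T_R a Y i j.
Proof.
move=> r0; rewrite mxE; under eq_fun do rewrite mxE.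
by apply: cvg_div => //; exact: cvg_row_ratio.
Qed.

Lemma cvg_T_C (b : 'rV[R]_q) i j : col_ratio b Y j != 0 ->
  T_C b (X n) i j @[n --> F] --> T_C b Y i j.
Proof.
move=> r0; rewrite mxE; under eq_fun do rewrite mxE.
by apply: cvg_div => //; exact: cvg_col_ratio.
Qed.

End Continuity.

(** * Convergence of the alternating scalings *)

Section AlternatingScaling.
Context {R : realType} {p q : nat} (a : 'rV[R]_p) (b : 'rV[R]_q).
Context (ha : forall i, 0 < a ord0 i) (hb : forall j, 0 < b ord0 j).
Context (ha1 : \sum_i a ord0 i = 1).
Context (Q : nat -> 'M[R]_(p, q)) (Q0 : Gamma0 (Q 0%N)).
Context (Qb0 : forall j, col_sum (Q 0%N) j = b ord0 j).
Context (QS : forall n, Q n.+1 = T_C b (T_R a (Q n))).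

Let P n := T_R a (Q n).
Let rho n i := row_ratio a (Q n) i.
Let gam n j := col_ratio b (P n) j.

Lemma alt_Gamma0 n : Gamma0 (Q n).
Proof.
by elim: n => // n IH; rewrite QS; apply: Gamma0_T_C => //; exact: Gamma0_T_R.
Qed.

Lemma alt_Gamma0_half n : Gamma0 (P n).
Proof. by apply: Gamma0_T_R => //; exact: alt_Gamma0. Qed.

Lemma alt_col_sum n j : col_sum (Q n) j = b ord0 j.
Proof.
case: n => // n; rewrite QS col_sum_T_C //.
by case: (alt_Gamma0_half n).
Qed.

Lemma alt_row_sum n i : row_sum (P n) i = a ord0 i.
Proof. by rewrite row_sum_T_R //; case: (alt_Gamma0 n). Qed.

Let rho_gt0 n i : 0 < rho n i.
Proof. exact: row_ratio_gt0 (alt_Gamma0 n). Qed.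

Let gam_gt0 n j : 0 < gam n j.
Proof. exact: col_ratio_gt0 (alt_Gamma0_half n). Qed.

(** Row ratios and column ratios are averages of the inverses of the preceding
    ones, so that bounds on the initial ratios are kept forever. *)
Lemma alt_bounds : exists m M, [/\ 0 < m, 0 < M,
  forall n i, m <= rho n i <= M & forall n j, M^-1 <= gam n j <= m^-1].
Proof.
pose M := 1 + \sum_i rho 0%N i; pose w := 1 + \sum_i (rho 0%N i)^-1.
have M0 : 0 < M by rewrite ltr_pwDl // sumr_ge0 // => i _; exact: ltW.
have w0 : 0 < w.
  by rewrite ltr_pwDl // sumr_ge0 // => i _; rewrite invr_ge0 ltW.
have w'0 : 0 < w^-1 by rewrite invr_gt0.
have rM n i : w^-1 <= rho n i <= M.
  elim: n i => [|n IH] i.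
    apply/andP; split.
      rewrite invf_ple ?posrE // /w (bigD1 i) //= addrCA lerDl addr_ge0 //.
      by rewrite sumr_ge0 // => k _; rewrite invr_ge0 ltW.
    rewrite /M (bigD1 i) //= addrCA lerDl addr_ge0 //.
    by rewrite sumr_ge0 // => k _; rewrite ltW.
  have Mi0 : 0 < M^-1 by rewrite invr_gt0.
  have [G0 _ _] := alt_Gamma0 n; have [H0 _ _] := alt_Gamma0_half n.
  have := col_ratio_T_R_bounds hb G0 (alt_col_sum n) w'0 IH.
  move=> /(row_ratio_T_C_bounds ha H0 (alt_row_sum n) Mi0)/(_ i).
  by rewrite !invrK /rho QS.
exists w^-1, M; split=> // n j; have [G0 _ _] := alt_Gamma0 n.
exact: (col_ratio_T_R_bounds hb G0 (alt_col_sum n) w'0 (rM n)).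
Qed.

Let total_half n : total_sum (P n) = 1.
Proof. by rewrite -ha1; apply: eq_bigr => i _; exact: alt_row_sum. Qed.

Let halfM n i j : P n i j * rho n i = Q n i j.
Proof. by rewrite mxE divfK // gt_eqF // rho_gt0. Qed.

Let nextE n i j : P n i j / gam n j = Q n.+1 i j.
Proof. by rewrite QS [RHS]mxE. Qed.

Let col_half n j : col_sum (P n) j = b ord0 j * gam n j.
Proof. by rewrite /gam /col_ratio mulrC divfK // gt_eqF // hb. Qed.

(** [- Phi n] is the entropy of [P n] relative to [Q n] and [Psi n] is its
    entropy relative to [Q n.+1]: each of the two matrices is in turn the best
    approximation of the other, hence the chain
    [Phi n <= - Psi n <= Phi n.+1]. *)
Let Phi n := \sum_i a ord0 i * ln (rho n i).
Let Psi n := \sum_j b ord0 j * gam n j * ln (gam n j).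

Lemma Phi_add_Psi_le0 n : Phi n + Psi n <= 0.
Proof.
have [P0 _ _] := alt_Gamma0_half n.
rewrite /Phi /Psi; under eq_bigr do rewrite -(alt_row_sum n).
under [X in _ + X]eq_bigr do rewrite -col_half.
apply: jensen_ln_scale => //.
under eq_bigr do under eq_bigr do rewrite mulrA halfM.
rewrite exchange_big /= -(total_half n) total_sum_col.
by apply: eq_bigr => j _; rewrite -mulr_suml -/(col_sum _ j) alt_col_sum col_half.
Qed.

Lemma opp_Psi_le_Phi n : - Psi n <= Phi n.+1.
Proof.
have [P0 _ _] := alt_Gamma0_half n.
rewrite -subr_ge0 -oppr_le0 opprB -opprD addrC opprD /Phi /Psi -!sumrN.
under eq_bigr do rewrite -mulrN -lnV ?posrE // -(alt_row_sum n).
under [X in _ + X]eq_bigr do rewrite -mulrN -lnV ?posrE // -col_half.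
apply: jensen_ln_scale => // [i|j|]; rewrite ?invr_gt0 //.
rewrite -(total_half n.+1); apply: eq_bigr => i _; apply: eq_bigr => j _.
by rewrite mulrCA nextE mxE mulrC.
Qed.

Section Limit.
Context (G : set_system nat) {GP : ProperFilter G} (oG : \oo `<=` G).
Context (Y : 'M[R]_(p, q)).
Hypothesis QY : forall i j, Q n i j @[n --> G] --> Y i j.
Let Z := T_R a Y.

Lemma lim_row_ratio_gt0 i : 0 < row_ratio a Y i.
Proof.
have [m [M [m0 _ mM _]]] := alt_bounds; apply: lt_le_trans m0 _.
apply: (cvgr_to_ge (cvg_row_ratio QY (a := a) (i := i))).
by apply: filterE => n; case/andP: (mM n i).
Qed.

Lemma cvg_half i j : P n i j @[n --> G] --> Z i j.
Proof. by apply: cvg_T_R => //; rewrite gt_eqF // lim_row_ratio_gt0. Qed.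

Lemma lim_col_ratio_gt0 j : 0 < col_ratio b Z j.
Proof.
have [m [M [_ M0 _ mM]]] := alt_bounds.
apply: (@lt_le_trans _ _ M^-1); first by rewrite invr_gt0.
apply: (cvgr_to_ge (cvg_col_ratio cvg_half (b := b) (j := j))).
by apply: filterE => n; case/andP: (mM n j).
Qed.

Lemma lim_ge0 i j : 0 <= Y i j.
Proof.
apply: (cvgr_to_ge (@QY i j)); apply: filterE => n.
by case: (alt_Gamma0 n).
Qed.

Lemma lim_half_ge0 i j : 0 <= Z i j.
Proof.
by rewrite mxE divr_ge0 ?lim_ge0 // ltW // lim_row_ratio_gt0.
Qed.

Lemma lim_col_sum j : col_sum Y j = b ord0 j.
Proof.
have h : col_sum (Q n) j @[n --> G] --> col_sum Y j by exact: cvg_sum.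
have h' : col_sum (Q n) j @[n --> G] --> b ord0 j.
  by under eq_fun do rewrite alt_col_sum; exact: cvg_cst.
exact: cvg_unique h h'.
Qed.

Lemma lim_row_sum_gt0 i : 0 < row_sum Y i.
Proof.
by have := lim_row_ratio_gt0 i; rewrite /row_ratio pmulr_lgt0 // invr_gt0.
Qed.

Lemma lim_row_sum i : row_sum Z i = a ord0 i.
Proof. by rewrite row_sum_T_R // => k; exact: lim_row_sum_gt0. Qed.

(** A zero entry stays zero along the whole sequence, hence in the limit. *)
Lemma lim_half_supp n i j : 0 < Z i j -> 0 < P n i j.
Proof.
move=> Zp; have [P0 _ _] := alt_Gamma0_half n.
rewrite lt_def P0 andbT; apply: contraTneq Zp => Pn0.
suff h : P k i j @[k --> G] --> (0 : R).
  by rewrite (cvg_unique _ (@cvg_half i j) h) ?ltxx.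
have tail k : (n <= k)%N -> P k i j = 0.
  move=> /subnK <-; elim: (k - n)%N => // l IH.
  by rewrite /P mxE -nextE IH !mul0r.
apply: cvg_near_cst; apply: oG.
by exists n => // k /= /tail.
Qed.

(** The decrease of the entropy is
    [- Phi n.+1 - \sum_j col_sum Z j * ln (gam n j)].  Gibbs' inequality and the
    monotonicity of [Phi] bound the opposite of this number by the limit of
    [Phi + Psi] along [G], which is non-positive. *)
Let kl_half_le n : kl Z (P n.+1) <= kl Z (P n).
Proof.
pose u i := (rho n.+1 i)^-1; pose v j := (gam n j)^-1.
have u0 i : 0 < u i by rewrite invr_gt0.
have v0 j : 0 < v j by rewrite invr_gt0.
have PS i j : P n.+1 i j = P n i j * (u i * v j).
  by rewrite mulrCA nextE mxE mulrC.
rewrite (kl_scale lim_half_ge0 (@lim_half_supp n) u0 v0 PS) lerDl.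
pose gY j := col_ratio b Z j.
have colZ j : col_sum Z j = b ord0 j * gY j.
  by rewrite mulrC divfK // gt_eqF.
have totZ : total_sum Z = 1.
  by rewrite -ha1; apply: eq_bigr => i _; exact: lim_row_sum.
rewrite -oppr_le0 opprD -!sumrN.
under eq_bigr do rewrite -mulrN /u lnV ?posrE // opprK lim_row_sum.
under [X in _ + X]eq_bigr do rewrite -mulrN /v lnV ?posrE // opprK.
rewrite -/(Phi n.+1).
(* This is Jensen's inequality with all row factors equal to 1. *)
have gibbs : \sum_j col_sum Z j * ln (gam n j) <= \sum_j col_sum Z j * ln (gY j).
  rewrite -subr_le0 -sumrB.
  have -> : \sum_j (col_sum Z j * ln (gam n j) - col_sum Z j * ln (gY j)) =
      \sum_i row_sum Z i * ln 1 + \sum_j col_sum Z j * ln (gam n j / gY j).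
    rewrite [X in _ = X + _]big1 ?add0r => [|i _]; last by rewrite ln1 mulr0.
    apply: eq_bigr => j _.
    by rewrite ln_div ?posrE // ?lim_col_ratio_gt0 // mulrBr.
  apply: (jensen_ln_scale lim_half_ge0) => // [j|].
    by rewrite divr_gt0 // lim_col_ratio_gt0.
  rewrite exchange_big /= -[RHS](total_half n) total_sum_col; apply: eq_bigr => j _.
  rewrite -mulr_suml -/(col_sum Z j) mul1r colZ col_half.
  by field; rewrite gt_eqF // lim_col_ratio_gt0.
have PhiG : Phi n @[n --> G] --> \sum_i a ord0 i * ln (row_ratio a Y i).
  apply: cvg_sum => i; apply: cvgMl_tmp; apply: cvg_ln.
    exact: lim_row_ratio_gt0.
  exact: cvg_row_ratio.
have PsiG : Psi n @[n --> G] --> \sum_j col_sum Z j * ln (gY j).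
  apply: cvg_sum => j; rewrite colZ; apply: cvgM.
    by apply: cvgMl_tmp; apply: cvg_col_ratio; exact: cvg_half.
  apply: cvg_ln; first exact: lim_col_ratio_gt0.
  by apply: cvg_col_ratio; exact: cvg_half.
have PhiS k : Phi k <= Phi k.+1.
  by rewrite (le_trans _ (opp_Psi_le_Phi k)) // -subr_ge0 -oppr_le0 opprB opprK Phi_add_Psi_le0.
have Phi_le : Phi n.+1 <= \sum_i a ord0 i * ln (row_ratio a Y i).
  apply: (cvgr_to_ge PhiG); apply: oG; exists n.+1 => // k /= /subnK <-.
  by elim: (k - n.+1)%N => // l /le_trans; apply.
have le0 : \sum_i a ord0 i * ln (row_ratio a Y i) +
    \sum_j col_sum Z j * ln (gY j) <= 0.
  by apply: (cvgr_to_le (cvgD PhiG PsiG)); apply: filterE => k; exact: Phi_add_Psi_le0.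
by rewrite (le_trans (lerD Phi_le gibbs)).
Qed.

(** The entropies [kl Z (P n)] decrease and tend to 0 along [G], hence along
    the whole sequence. *)
Lemma alt_half_cvg i j : P n i j @[n --> \oo] --> Z i j.
Proof.
have hk n : hellinger Z (P n) <= kl Z (P n).
  have [P0 _ _] := alt_Gamma0_half n.
  apply: kl_ge_hellinger => //; [exact: lim_half_ge0|exact: lim_half_supp|].
  by rewrite total_half -ha1; apply: eq_bigr => k _; exact: lim_row_sum.
move: i j; apply: cvg_of_hellinger; first exact: lim_half_ge0.
  by move=> n i j; case: (alt_Gamma0_half n).
apply/cvgrPdist_le => e e0.
have klG := cvg_kl GP lim_half_ge0 cvg_half.
have /filter_ex[N kN] : \forall n \near G, kl Z (P n) <= e.
  exact: (cvgr_le 0 klG).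
exists N => // n /= Nn.
rewrite sub0r normrN ger0_norm ?hellinger_ge0 // (le_trans (hk n)) //.
apply: le_trans kN; rewrite -(subnK Nn).
by elim: (n - N)%N => // l; apply: le_trans; exact: kl_half_le.
Qed.

Lemma alt_cvg i j : Q n i j @[n --> \oo] --> T_C b Z i j.
Proof.
apply: cvg_unsucc; under eq_fun do rewrite QS.
apply: cvg_T_C; first exact: alt_half_cvg.
by rewrite gt_eqF // lim_col_ratio_gt0.
Qed.

(** Both sides are the limit of [Q] along [G]. *)
Lemma alt_lim_fixed : Y = T_C b Z.
Proof.
apply/matrixP => i j; have h := @alt_cvg i j.
have hG : Q n i j @[n --> G] --> T_C b Z i j.
  by move=> A /h hA; exact: oG.
exact: cvg_unique (@QY i j) hG.
Qed.

End Limit.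

(** A cluster point [Y] of the bounded sequence [Q] is found as a limit along an
    ultrafilter; the previous lemmas turn it into an actual limit. *)
Theorem alternating_scaling_cvg : exists Y : 'M[R]_(p, q),
  let Z := T_R a Y in
  [/\ forall i j, Q n i j @[n --> \oo] --> Y i j,
      forall i j, T_R a (Q n) i j @[n --> \oo] --> Z i j,
      Gamma0 Y, forall j, col_sum Y j = b ord0 j & Y = T_C b Z].
Proof.
have [G [GU oG]] := @ultraFilterLemma _ \oo _.
have GP : ProperFilter G by exact: ultra_proper.
have /choice[f fP] (ij : 'I_p * 'I_q) :
    exists l : R, Q n ij.1 ij.2 @[n --> G] --> l.
  apply: (@ultra_cvg_bounded _ _ _ _ 0 (b ord0 ij.2)) => n.
  have [G0 _ _] := alt_Gamma0 n; rewrite G0 -(alt_col_sum n).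
  by rewrite /col_sum (bigD1 ij.1) //= lerDl sumr_ge0.
pose Y : 'M[R]_(p, q) := \matrix_(i, j) f (i, j).
have QY i j : Q n i j @[n --> G] --> Y i j by rewrite mxE; exact: (fP (i, j)).
have fixY := alt_lim_fixed oG QY.
exists Y; split=> [i j|i j||j|]; last exact: fixY.
- by rewrite fixY; exact: (@alt_cvg G GP oG Y QY).
- exact: (@alt_half_cvg G GP oG Y QY).
- split=> [i j|i|j]; first exact: lim_ge0 QY i j.
    exact: (lim_row_sum_gt0 QY).
  by rewrite (lim_col_sum QY).
- exact: lim_col_sum QY j.
Qed.

End AlternatingScaling.
(** * Geometric rate *)

Lemma cvg_geometrically_ratios (R : realType) (x : nat -> R) (s t : R) :
  (forall n, 0 < x n) -> 0 < s -> 0 < t -> s * t < 1 ->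
  x n.*2.+1 / x n.*2 @[n --> \oo] --> s ->
  x n.*2.+2 / x n.*2.+1 @[n --> \oo] --> t ->
  x n @[n --> \oo] --> 0 -> cvg_geometrically (x : nat -> R^o) 0.
Proof.
move=> x0 s0 t0 st xs xt x_0; split=> //.
exists (expR ((ln s + ln t) / 2)); split; first exact: expR_gt0.
  by rewrite expR_lt1 pmulr_llt0 // -lnM ?posrE // ln_lt0 // mulr_gt0.
have h := cvg_ln_div_n x0 s0 t0 xs xt.
apply: (eq_cvg_to (continuous_cvg _ (@continuous_expR R _) h)) => // n /=.
by rewrite subr0 gtr0_norm // /powR gt_eqF // mulrC.
Qed.

(** * Entropy minimisers as limits of scalings *)

Section Minimizer.
Context {R : realType} {p q : nat}.
Implicit Types (S X Y : 'M[R]_(p, q)).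

Definition is_scaling X Y := exists (u : 'I_p -> R) (v : 'I_q -> R),
  [/\ forall i, 0 < u i, forall j, 0 < v j &
      forall i j, Y i j = X i j * (u i * v j)].

Lemma SuppP S X :
  reflect (forall i j, 0 < S i j -> 0 < X i j) (Supp S \subset Supp X).
Proof.
apply: (iffP fintype.subsetP) => h => [i j Sij|[i j]].
  by have := h (i, j); rewrite !inE; exact.
by rewrite !inE; exact: h.
Qed.

Lemma rel_entropyE S X : (forall i j, 0 <= S i j) -> Supp S \subset Supp X ->
  rel_entropy S X = (kl S X)%:E.
Proof.
move=> S0 SX; rewrite /rel_entropy SX; congr (_%:E).
rewrite /kl pair_bigA /= big_mkcond /=; apply: eq_bigr => -[i j] _ /=.
case: ifPn => // nX; suff -> : S i j = 0 by rewrite mul0r.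
apply/eqP; rewrite eq_le S0 andbT leNgt; apply: contra nX.
by rewrite inE; exact/SuppP.
Qed.

Lemma cvg_hellinger (T : Type) (F : set_system T) (Z : T -> 'M[R]_(p, q)) S Y :
  Filter F -> (forall i j, Z n i j @[n --> F] --> Y i j) ->
  hellinger S (Z n) @[n --> F] --> hellinger S Y.
Proof.
move=> FF ZY; apply: cvg_sum => i; apply: cvg_sum => j.
have d : Num.sqrt (S i j) - Num.sqrt (Z n i j) @[n --> F] -->
    Num.sqrt (S i j) - Num.sqrt (Y i j).
  apply: cvgB; first exact: cvg_cst.
  have h : Z n i j @[n --> F] --> Y i j by exact: ZY.
  exact: (continuous_cvg FF (@sqrt_continuous R _) h).
exact: eq_cvg_to (cvgM d d) _ _.
Qed.

(** Since scalings change the entropy of all matrices of a class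
    [Gamma alpha beta] by the same amount, [kl S X0 - kl Y X0] equals
    [kl S (Z n) - kl Y (Z n)]; its second term tends to 0 and its first term is
    at least the Hellinger distance to [Z n].  The Hellinger term in the limit
    gives uniqueness together with minimality. *)
Lemma kl_scaled_limit (X0 : 'M[R]_(p, q)) (Z : nat -> 'M[R]_(p, q))
    (alpha : 'rV[R]_p) (beta : 'rV[R]_q) Y S :
  (forall n, is_scaling X0 (Z n)) ->
  (forall i j, 0 <= X0 i j) -> (forall n, total_sum (Z n) = 1) ->
  \sum_i alpha ord0 i = 1 ->
  (forall i j, Z n i j @[n --> \oo] --> Y i j) ->
  Gamma_in alpha beta X0 Y -> Gamma_in alpha beta X0 S ->
  kl Y X0 + hellinger S Y <= kl S X0.
Proof.
move=> Zuv X00 Z1 a1 ZY [[[Y0 _ _] Yr Yc] /SuppP YX].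
move=> [[[S0 _ _] Sr Sc] /SuppP SX].
have step n : kl Y X0 + (hellinger S (Z n) - kl Y (Z n)) <= kl S X0.
  have [u [v [u0 v0 ZE]]] := Zuv n.
  rewrite (kl_scale Y0 YX u0 v0 ZE) (kl_scale S0 SX u0 v0 ZE).
  have -> : \sum_i row_sum S i * ln (u i) = \sum_i row_sum Y i * ln (u i).
    by apply: eq_bigr => i _; rewrite Sr Yr.
  have -> : \sum_j col_sum S j * ln (v j) = \sum_j col_sum Y j * ln (v j).
    by apply: eq_bigr => j _; rewrite Sc Yc.
  rewrite addrAC lerD2r addrC subrK; apply: kl_ge_hellinger => //.
  - by move=> i j; rewrite ZE mulr_ge0 // ltW // mulr_gt0.
  - by move=> i j /SX X0p; rewrite ZE !mulr_gt0.
  - by rewrite Z1 -a1; apply: eq_bigr => i _; exact: Sr.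
have lim : kl Y X0 + (hellinger S (Z n) - kl Y (Z n)) @[n --> \oo] -->
    kl Y X0 + (hellinger S Y - 0).
  apply: cvgD; first exact: cvg_cst.
  by apply: cvgB; [exact: cvg_hellinger|exact: cvg_kl].
rewrite -[hellinger S Y]subr0; apply: (cvgr_to_le lim).
by apply: filterE => n; exact: step.
Qed.

Lemma scaled_limit_unique_minimizer (X0 : 'M[R]_(p, q))
    (Z : nat -> 'M[R]_(p, q)) (alpha : 'rV[R]_p) (beta : 'rV[R]_q) Y :
  (forall n, is_scaling X0 (Z n)) ->
  (forall i j, 0 <= X0 i j) -> (forall n, total_sum (Z n) = 1) ->
  \sum_i alpha ord0 i = 1 ->
  (forall i j, Z n i j @[n --> \oo] --> Y i j) ->
  Gamma_in alpha beta X0 Y ->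
  unique_minimizer (fun S => rel_entropy S X0) (Gamma_in alpha beta X0) Y.
Proof.
move=> Zuv X00 Z1 a1 ZY GY.
have entE S : Gamma_in alpha beta X0 S -> rel_entropy S X0 = (kl S X0)%:E.
  by case=> [[[S0 _ _] _ _] SX]; exact: rel_entropyE.
have key S := kl_scaled_limit Zuv X00 Z1 a1 ZY GY (S := S).
split=> // [S GS|S GS Smin].
  rewrite !entE // lee_fin (le_trans _ (key S GS)) // lerDl.
  exact: hellinger_ge0.
have := Smin Y GY; rewrite !entE // lee_fin => /(le_trans (key S GS)).
rewrite gerDl; case: GS GY => [[[S0 _ _] _ _] _] [[[Y0 _ _] _ _] _].
exact: hellinger_le0.
Qed.

End Minimizer.

(** * The iterative proportional fitting procedure *)

Section Ipfp.
Context {R : realType} {p q : nat} (a : 'rV[R]_p) (b : 'rV[R]_q).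
Context (ha : forall i, 0 < a ord0 i) (hb : forall j, 0 < b ord0 j).
Context (ha1 : \sum_i a ord0 i = 1) (hb1 : \sum_j b ord0 j = 1).
Context (X0 : 'M[R]_(p, q)) (hX0 : Gamma1 X0).
Let X := ipfp a b X0.

Lemma ipfp_odd n : X n.*2.+1 = T_R a (X n.*2).
Proof. by rewrite /X /= odd_double. Qed.

Lemma ipfp_even n : X n.*2.+2 = T_C b (X n.*2.+1).
Proof. by rewrite /X /= odd_double. Qed.

Lemma ipfp_Gamma0 n : Gamma0 (X n).
Proof.
elim: n => [|n IH]; first by case: hX0.
by rewrite /X /=; case: (odd n); [exact: Gamma0_T_C|exact: Gamma0_T_R].
Qed.

Lemma ipfp_total n : total_sum (X n) = 1.
Proof.
case: n => [|n]; first by case: hX0.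
have [_ Xr Xc] := ipfp_Gamma0 n.
rewrite /X /=; case: (odd n).
  by rewrite total_sum_col -hb1; apply: eq_bigr => j _; exact: col_sum_T_C.
by rewrite -ha1; apply: eq_bigr => i _; exact: row_sum_T_R.
Qed.

Lemma ipfp_scaled n : is_scaling X0 (X n).
Proof.
elim: n => [|n [u [v [u0 v0 XE]]]].
  by exists (fun=> 1), (fun=> 1); split=> // i j; rewrite !mulr1.
have G := ipfp_Gamma0 n; rewrite /X /= -/X; case: (odd n).
  exists u, (fun j => v j / col_ratio b (X n) j); split=> // [j|i j].
    by rewrite divr_gt0 // col_ratio_gt0.
  by rewrite mxE XE !mulrA.
exists (fun i => u i / row_ratio a (X n) i), v; split=> // [i|i j].
  by rewrite divr_gt0 // row_ratio_gt0.
by rewrite mxE XE -!mulrA; congr (_ * (_ * _)); rewrite mulrC.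
Qed.

Lemma ipfp_gt0 n i j : 0 < X0 i j -> 0 < X n i j.
Proof.
by have [u [v [u0 v0 ->]]] := ipfp_scaled n => X0p; rewrite !mulr_gt0.
Qed.

Lemma ipfp_eq0 n i j : X0 i j <= 0 -> X n i j = 0.
Proof.
have [[X00 _ _] _] := hX0 => X0n.
have [u [v [_ _ ->]]] := ipfp_scaled n.
suff -> : X0 i j = 0 by rewrite mul0r.
by apply/eqP; rewrite eq_le X0n X00.
Qed.

(** The column sums of [X0] are arbitrary, so the alternating scalings are taken
    from [X 2] on. *)
Lemma ipfp_cvg : exists Y : 'M[R]_(p, q), let Z := T_R a Y in
  [/\ forall i j, X n.*2 i j @[n --> \oo] --> Y i j,
      forall i j, X n.*2.+1 i j @[n --> \oo] --> Z i j,
      Gamma0 Y, forall j, col_sum Y j = b ord0 j & Y = T_C b Z].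
Proof.
have [||n|Y [XY XZ GY Yb YE]] :=
  @alternating_scaling_cvg _ _ _ a b ha hb ha1 (fun n => X n.+1.*2).
- exact: ipfp_Gamma0.
- by move=> j; rewrite -[X _]/(X 0.*2.+2) ipfp_even col_sum_T_C //; case: (ipfp_Gamma0 1).
- by rewrite doubleS ipfp_even ipfp_odd.
exists Y; split=> // i j; first exact: (cvg_unsucc (@XY i j)).
apply: cvg_unsucc; apply: eq_cvg_to (@XZ i j) _ _ => // n.
by rewrite -ipfp_odd.
Qed.

Section Limit.
Context (Y : 'M[R]_(p, q)).
Let Z := T_R a Y.
Hypothesis XY : forall i j, X n.*2 i j @[n --> \oo] --> Y i j.
Hypothesis XZ : forall i j, X n.*2.+1 i j @[n --> \oo] --> Z i j.
Hypothesis GY : Gamma0 Y.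
Hypothesis Yb : forall j, col_sum Y j = b ord0 j.
Hypothesis YE : Y = T_C b Z.
Let rho i := row_ratio a Y i.
Let gam j := col_ratio b Z j.

Lemma rho_gt0 i : 0 < rho i.
Proof. exact: row_ratio_gt0. Qed.

Lemma gam_gt0 j : 0 < gam j.
Proof. by apply: col_ratio_gt0 => //; exact: Gamma0_T_R. Qed.

Lemma limit_supp i j : 0 < Y i j -> rho i * gam j = 1.
Proof.
move=> Yp; have t0 : rho i * gam j != 0.
  by rewrite mulf_neq0 // gt_eqF ?rho_gt0 ?gam_gt0.
have ZYE : Z i j = Y i j / rho i by rewrite mxE.
have e : Y i j = Y i j / (rho i * gam j).
  by rewrite {1}YE mxE ZYE -mulrA -invfM.
apply: (mulfI (lt0r_neq0 Yp)).
by rewrite mulr1 {1}e divfK.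
Qed.

Lemma limit_odd_supp i j : 0 < Z i j -> rho i * gam j = 1.
Proof.
by rewrite mxE pmulr_lgt0 ?invr_gt0 ?rho_gt0 //; exact: limit_supp.
Qed.

Lemma cvg_rho i : row_ratio a (X n.*2) i @[n --> \oo] --> rho i.
Proof. exact: cvg_row_ratio. Qed.

Lemma cvg_gam j : col_ratio b (X n.*2.+1) j @[n --> \oo] --> gam j.
Proof. exact: cvg_col_ratio. Qed.

(** Otherwise the entry would eventually be non-decreasing along even times, so
    that its limit would be positive, which forces [rho i * gam j = 1]. *)
Lemma rho_gam_ge1 i j : 0 < X0 i j -> 1 <= rho i * gam j.
Proof.
move=> X0p; rewrite leNgt; apply/negP => lt1.
have [N _ hN] := cvgr_le _ (cvgM (@cvg_rho i) (@cvg_gam j)) _ lt1.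
have mono n : (N <= n)%N -> X n.*2 i j <= X n.+1.*2 i j.
  move=> /hN /= h; have G := ipfp_Gamma0.
  rewrite doubleS ipfp_even mxE ipfp_odd mxE -ipfp_odd -mulrA -invfM.
  apply: ler_peMr; first by apply: ltW; exact: ipfp_gt0.
  rewrite invf_ge1 //; last by rewrite mulr_gt0 ?row_ratio_gt0 ?col_ratio_gt0.
have YN : X N.*2 i j <= Y i j.
  apply: (cvgr_to_ge (@XY i j)); exists N => // n /= /subnK <-.
  elim: (n - N)%N => // l IH; apply: le_trans IH _.
  by apply: mono; rewrite leq_addl.
have := limit_supp (lt_le_trans (ipfp_gt0 N.*2 X0p) YN) => e.
by rewrite e ltxx in lt1.
Qed.

Lemma limit_eq0 i j : rho i * gam j != 1 -> Y i j = 0.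
Proof.
move=> ne1; have [Y0 _ _] := GY.
apply/eqP; rewrite eq_le Y0 andbT leNgt; apply: contra ne1 => /limit_supp ->.
exact: eqxx.
Qed.

Lemma ipfp_cvg0 i j : rho i * gam j != 1 -> X n i j @[n --> \oo] --> (0 : R).
Proof.
move=> /limit_eq0 Y0; apply: cvg_even_odd; first by rewrite -Y0.
by have -> : 0 = Z i j by rewrite mxE Y0 mul0r.
Qed.

Lemma ipfp_cvg_geometrically i j : 0 < X0 i j -> rho i * gam j != 1 ->
  cvg_geometrically (fun n => X n i j : R^o) 0.
Proof.
move=> X0p ne1; have Xp n := ipfp_gt0 n X0p.
have lt1 : 1 < rho i * gam j by rewrite lt_def ne1 rho_gam_ge1.
apply: (@cvg_geometrically_ratios _ _ (rho i)^-1 (gam j)^-1) => //.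
- by rewrite invr_gt0 rho_gt0.
- by rewrite invr_gt0 gam_gt0.
- by rewrite -invfM invf_lt1 // mulr_gt0 ?rho_gt0 ?gam_gt0.
- apply: (eq_cvg_to (cvgV _ (@cvg_rho i))) => // [|n].
    by rewrite gt_eqF // rho_gt0.
  by rewrite ipfp_odd mxE mulrAC divff ?mul1r // gt_eqF.
- apply: (eq_cvg_to (cvgV _ (@cvg_gam j))) => // [|n].
    by rewrite gt_eqF // gam_gt0.
  by rewrite ipfp_even mxE mulrAC divff ?mul1r // gt_eqF.
- exact: ipfp_cvg0.
Qed.

(** The sum of [S i j * (rho i - (gam j)^-1)] depends on the marginals of [S]
    only.  It vanishes for [T], and all its terms are non-negative for [S]. *)
Lemma supp_same_marginals (S T : 'M[R]_(p, q)) :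
  (forall i j, 0 <= S i j) -> (forall i j, 0 < S i j -> 0 < X0 i j) ->
  (forall i j, 0 <= T i j) -> (forall i j, 0 < T i j -> rho i * gam j = 1) ->
  (forall i, row_sum S i = row_sum T i) ->
  (forall j, col_sum S j = col_sum T j) ->
  forall i j, 0 < S i j -> rho i * gam j = 1.
Proof.
move=> S0 SX T0 TE Sr Sc.
have inv1 i j : rho i * gam j = 1 -> rho i - (gam j)^-1 = 0.
  move=> e; apply/eqP; rewrite subr_eq0 -[(gam j)^-1]mul1r -e mulfK //.
  by rewrite gt_eqF // gam_gt0.
have sS : \sum_i \sum_j S i j * (rho i - (gam j)^-1) = 0.
  rewrite (sum_scale S rho (fun j => - (gam j)^-1)).
  under eq_bigr do rewrite Sr; under [X in _ + X]eq_bigr do rewrite Sc.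
  rewrite -sum_scale big1 // => i _; rewrite big1 // => j _.
  have [/TE/inv1 ->|Tn] := ltP 0 (T i j); first by rewrite mulr0.
  have -> : T i j = 0 by apply/eqP; rewrite eq_le Tn T0.
  by rewrite mul0r.
have pos i j : 0 <= S i j * (rho i - (gam j)^-1).
  have [Sp|Sn] := ltP 0 (S i j); last first.
    have -> : S i j = 0 by apply/eqP; rewrite eq_le Sn S0.
    by rewrite mul0r.
  rewrite mulr_ge0 // subr_ge0 -[(gam j)^-1]mul1r ler_pdivrMr ?gam_gt0 //.
  exact: rho_gam_ge1 (SX _ _ Sp).
move=> i j Sp.
have si : \sum_j S i j * (rho i - (gam j)^-1) = 0.
  by apply: (psumr_eq0P _ sS) => // k _; exact: sumr_ge0.
have /eqP := psumr_eq0P (fun j _ => pos i j) si (i := j) isT.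
rewrite mulf_eq0 gt_eqF //= subr_eq0 => /eqP ->.
by rewrite mulVf // gt_eqF // gam_gt0.
Qed.

End Limit.
End Ipfp.

(** * Level sets *)

Lemma sorted_levels (R : realType) (T : finType) (f : T -> R) :
  exists (r : nat) (l : 'I_r -> R),
  [/\ forall k k' : 'I_r, (l k < l k') = (k < k')%N,
      forall i, exists k, f i = l k & forall k, exists i, f i = l k].
Proof.
pose s := sort <=%R (undup (codom f)).
have s_sorted : sorted <%R s by rewrite sort_lt_sorted undup_uniq.
have mem_s x : (x \in s) = (x \in codom f) by rewrite mem_sort mem_undup.
exists (size s), (fun k => s`_k); split=> [k k'|i|k].
- by rewrite (lt_sorted_ltn_nth 0 s_sorted) // inE.
- have fs : f i \in s by rewrite mem_s codom_f.
  have fi : (index (f i) s < size s)%N by rewrite index_mem.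
  by exists (Ordinal fi); rewrite /= nth_index.
- have : s`_k \in codom f by rewrite -mem_s mem_nth.
  by case/codomP=> i ->; exists i.
Qed.

Lemma level_set_partition (R : realType) (T : finType) (r : nat) (f : T -> R)
    (l : 'I_r -> R) :
  injective l -> (forall i, exists k, f i = l k) ->
  (forall k, exists i, f i = l k) ->
  is_indexed_partition (fun k => [set i | f i == l k])%SET /\ (r <= #|T|)%N.
Proof.
move=> l_inj fl lf; have /choice[g gE] := lf; split; last first.
  rewrite -[leqLHS]card_ord; apply: (@leq_card _ _ g) => k k' gk.
  by apply: l_inj; rewrite -!gE gk.
split=> [k k' /setP/(_ (g k))|].
  by rewrite !inE gE eqxx => /esym/eqP/l_inj.
apply/and3P; split.
- apply/eqP/setP => i; rewrite inE; apply/finset.bigcupP.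
  have [k fk] := fl i; exists [set i | f i == l k]%SET; first exact: imset_f.
  by rewrite inE fk.
- apply/finset.trivIsetP => A B /imsetP[k _ ->] /imsetP[k' _ ->] ne.
  rewrite -setI_eq0; apply: contraNT ne => /set0Pn[i].
  by rewrite !inE => /andP[/eqP-> /eqP/l_inj->].
- apply/imsetP => -[k _ /setP/(_ (g k))].
  by rewrite !inE gE eqxx.
Qed.

(** * Blocks and rescaling *)

Section Transfer.
Context {R : realType} {p q : nat}.

(** Rescaling the rows by [u] and rescaling the columns by [v] have the same
    effect on [S], so that the image has marginals [u * alpha] and
    [v * beta]. *)
Lemma Gamma_in_rescale (alpha alpha' : 'rV[R]_p) (beta beta' : 'rV[R]_q)
    (X0 S : 'M[R]_(p, q)) (u : 'I_p -> R) (v : 'I_q -> R) :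
  (forall i, 0 < u i) -> (forall j, 0 < v j) ->
  (forall i j, S i j * u i = S i j * v j) ->
  (forall i, alpha' ord0 i = alpha ord0 i * u i) ->
  (forall j, beta' ord0 j = beta ord0 j * v j) ->
  Gamma_in alpha beta X0 S ->
  Gamma_in alpha' beta' X0 (\matrix_(i, j) (S i j * u i)).
Proof.
move=> u0 v0 uv aE bE [[[S0 Sr Sc] Sa Sb] SX].
have rE i : row_sum (\matrix_(i, j) (S i j * u i)) i = row_sum S i * u i.
  by rewrite [RHS]mulr_suml; apply: eq_bigr => j _; rewrite mxE.
have cE j : col_sum (\matrix_(i, j) (S i j * u i)) j = col_sum S j * v j.
  by rewrite [RHS]mulr_suml; apply: eq_bigr => i _; rewrite mxE uv.
split; last first.
  by apply/SuppP => i j; rewrite mxE pmulr_lgt0 //; exact/SuppP.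
split=> [|i|j]; [split=> [i j|i|j]| |].
- by rewrite mxE mulr_ge0 // ltW.
- by rewrite rE mulr_gt0.
- by rewrite cE mulr_gt0.
- by rewrite rE Sa aE.
- by rewrite cE Sb bE.
Qed.

(** Both sides are the mass of [Y] in the rows of [I], which is also its mass in
    the columns of [J]. *)
Lemma block_mass (Y : 'M[R]_(p, q)) (I : {set 'I_p}) (J : {set 'I_q}) :
  (forall i j, Y i j != 0 -> (i \in I) = (j \in J)) ->
  \sum_(i in I) row_sum Y i = \sum_(j in J) col_sum Y j.
Proof.
move=> YIJ; rewrite big_mkcond [RHS]big_mkcond /=.
have -> : \sum_i (if i \in I then row_sum Y i else 0) =
    \sum_i \sum_j (if i \in I then Y i j else 0).
  by apply: eq_bigr => i _; case: ifP => // _; rewrite big1.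
rewrite exchange_big /=; apply: eq_bigr => j _.
have -> : (if j \in J then col_sum Y j else 0) =
    \sum_i (if j \in J then Y i j else 0).
  by case: ifP => // _; rewrite big1.
apply: eq_bigr => i _; have [->|/YIJ->//] := eqVneq (Y i j) 0.
by case: ifP; case: ifP.
Qed.

End Transfer.

(** * The limit of the procedure for arbitrary supports *)

(* In the fourth item the rate is asserted only where X0 i j > 0: elsewhere
   X_n(i,j) is identically 0, so that the limit of |X_n(i,j)|^(1/n) is 0. *)
Theorem theorem4 (R : realType) (p q : nat) (hp : (2 <= p)%N) (hq : (2 <= q)%N)
    (a : 'rV[R]_p) (b : 'rV[R]_q)
    (ha : forall i, 0 < a ord0 i) (hb : forall j, 0 < b ord0 j)
    (ha1 : \sum_(i < p) a ord0 i = 1) (hb1 : \sum_(j < q) b ord0 j = 1)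
    (X0 : 'M[R]_(p, q)) (hX0 : Gamma1 X0)
    (hempty : ~ exists S, Gamma a b S /\ Supp S \subset Supp X0) :
  let X := ipfp a b X0 in
  exists (r : nat) (I : 'I_r -> {set 'I_p}) (J : 'I_r -> {set 'I_q}),
  [/\ (0 < r)%N, (r <= minn p q)%N, is_indexed_partition I & is_indexed_partition J] /\
  let lambda (k : 'I_r) : R := vsum b (J k) / vsum a (I k) in
  exists (a' : 'rV[R]_p) (b' : 'rV[R]_q),
  (forall k i, i \in I k -> a' ord0 i / a ord0 i = lambda k) /\
  (forall k j, j \in J k -> b' ord0 j / b ord0 j = (lambda k)^-1) /\
  (* 1 *)
  (forall k i, i \in I k ->
     row_ratio a (X n.*2) i @[n --> \oo] --> lambda k) /\
  (* 2 *)
  (forall k j, j \in J k ->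
     col_ratio b (X n.*2.+1) j @[n --> \oo] --> (lambda k)^-1) /\
  (* 3 *)
  (forall (k k' : 'I_r) i j, (k < k')%N -> i \in I k -> j \in J k' ->
     forall n, X n i j = 0) /\
  (* 4 *)
  (forall (k k' : 'I_r) i j, (k' < k)%N -> i \in I k -> j \in J k' ->
     X n i j @[n --> \oo] --> (0 : R) /\
     (0 < X0 i j -> cvg_geometrically (fun n => X n i j : R^o) 0)) /\
  (* 5 *)
  (exists Y, unique_minimizer (fun Z => rel_entropy Z X0) (Gamma_in a' b X0) Y /\
     X n.*2 @[n --> \oo] --> Y) /\
  (* 6 *)
  (exists Y, unique_minimizer (fun Z => rel_entropy Z X0) (Gamma_in a b' X0) Y /\
     X n.*2.+1 @[n --> \oo] --> Y) /\
  (* 7 *)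
  ((forall k, vsum a' (I k) = vsum b (J k) /\ vsum a (I k) = vsum b' (J k)) /\
   (forall S, Gamma_in a' b X0 S \/ Gamma_in a b' X0 S ->
      Supp S \subset (\bigcup_(k < r) finset.setX (I k) (J k))%SET)) /\
  (* 8 *)
  (let D1 : 'M[R]_p := diag_mx (\row_i (a' ord0 i / a ord0 i)) in
   let D2 : 'M[R]_q := diag_mx (\row_j (b ord0 j / b' ord0 j)) in
   (forall S, Gamma_in a b' X0 S ->
      D1 *m S = S *m D2 /\ Gamma_in a' b X0 (D1 *m S)) /\
   (forall T, Gamma_in a' b X0 T ->
      exists S, Gamma_in a b' X0 S /\ T = D1 *m S)).
Proof.
move=> X.
have [Y [XY XZ GY Yb YE]] := ipfp_cvg ha hb ha1 hX0.
set Z := T_R a Y in XZ YE.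
pose rho i := row_ratio a Y i; pose gam j := col_ratio b Z j.
have rho0 i : 0 < rho i by exact: rho_gt0.
have gam0 j : 0 < gam j by exact: gam_gt0.
have GZ : Gamma0 Z by exact: Gamma0_T_R.
have [[Y0 Yr Yc] [Z0 Zr Zc]] := (GY, GZ).
have [[X00 _ _] _] := hX0.
have Ysupp i j : 0 < Y i j -> rho i * gam j = 1 by exact: limit_supp.
have Zsupp i j : 0 < Z i j -> rho i * gam j = 1 by exact: limit_odd_supp.
have ge1 i j : 0 < X0 i j -> 1 <= rho i * gam j by exact: rho_gam_ge1.
have ne0_gt0 i j : Y i j != 0 -> 0 < Y i j by rewrite lt_def Y0 andbT.
have gamV i j : rho i * gam j = 1 -> (gam j)^-1 = rho i.
  by move=> e; rewrite -[LHS]mul1r -e mulfK // gt_eqF.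
have [r [l [l_mono rhol lrho]]] := sorted_levels rho.
have l_inj : injective l.
  move=> k k' lk; have [|| /val_inj//] := ltngtP k k'.
    by rewrite -l_mono lk ltxx.
  by rewrite -l_mono lk ltxx.
have rowY i : exists j, 0 < Y i j.
  apply/existsP; apply: contraT => /existsPn h; have := Yr i.
  by rewrite /row_sum big1 ?ltxx // => j _; apply/eqP; apply: contraNT (h j);
     exact: ne0_gt0.
have colY j : exists i, 0 < Y i j.
  apply/existsP; apply: contraT => /existsPn h; have := Yc j.
  by rewrite /col_sum big1 ?ltxx // => i _; apply/eqP; apply: contraNT (h i);
     exact: ne0_gt0.
have gaml j : exists k, (gam j)^-1 = l k.
  have [i /Ysupp/gamV ->] := colY j; exact: rhol.
have lgam k : exists j, (gam j)^-1 = l k.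
  have [i <-] := lrho k; have [j /Ysupp/gamV <-] := rowY i; by exists j.
have [Ipart rp] := level_set_partition l_inj rhol lrho.
have [Jpart rq] := level_set_partition l_inj gaml lgam.
rewrite !card_ord in rp rq.
exists r, (fun k => [set i | rho i == l k])%SET,
  (fun k => [set j | (gam j)^-1 == l k])%SET; split.
  split=> //; last by rewrite leq_min rp.
  have [k _] := rhol (Ordinal (ltnW hp)); exact: leq_ltn_trans (ltn_ord k).
move=> lambda.
have l0 k : 0 < l k by have [i <-] := lrho k.
pose a' : 'rV[R]_p := \row_i (a ord0 i * rho i).
pose b' : 'rV[R]_q := \row_j (b ord0 j * gam j).
have Ya i : row_sum Y i = a' ord0 i.
  by rewrite mxE /rho /row_ratio mulrC divfK // gt_eqF.
have Za i : row_sum Z i = a ord0 i by exact: row_sum_T_R.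
have Zb j : col_sum Z j = b' ord0 j.
  by rewrite mxE /gam /col_ratio mulrC divfK // gt_eqF.
have a'E k : vsum a' [set i | rho i == l k]%SET =
             l k * vsum a [set i | rho i == l k]%SET.
  rewrite /vsum mulr_sumr; apply: eq_bigr => i; rewrite inE mxE => /eqP->.
  exact: mulrC.
have b'E k : vsum b' [set j | (gam j)^-1 == l k]%SET =
             (l k)^-1 * vsum b [set j | (gam j)^-1 == l k]%SET.
  rewrite /vsum mulr_sumr; apply: eq_bigr => j; rewrite inE mxE => /eqP<-.
  by rewrite invrK mulrC.
have mass k : vsum a' [set i | rho i == l k]%SET =
              vsum b [set j | (gam j)^-1 == l k]%SET.
  have := @block_mass _ _ _ Y [set i | rho i == l k]%SET
    [set j | (gam j)^-1 == l k]%SET.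
  under eq_bigr do rewrite Ya; under [RHS]eq_bigr do rewrite Yb; apply=> i j.
  by move=> /ne0_gt0/Ysupp/gamV e; rewrite !inE e.
(* Combine [mass] with [a' (I k) = l k * a (I k)], where [a (I k) > 0]. *)
have lE k : lambda k = l k.
  rewrite /lambda -mass a'E mulfK // gt_eqF //.
  have [i ri] := lrho k; rewrite /vsum (bigD1 i) ?inE ?ri //=.
  by rewrite ltr_pwDl // sumr_ge0 // => i' _; exact: ltW.
have GYin : Gamma_in a' b X0 Y.
  split; first by split.
  apply/SuppP => i j Yp; rewrite ltNge; apply/negP => X0n.
  have Y_0 : Y i j = 0.
    have h : X n.*2 i j @[n --> \oo] --> (0 : R).
      by apply: cvg_near_cst; apply: filterE => n; rewrite ipfp_eq0.
    exact: cvg_unique (@XY i j) h.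
  by rewrite Y_0 ltxx in Yp.
have GZin : Gamma_in a b' X0 Z.
  split; first by split.
  apply/SuppP => i j; rewrite mxE pmulr_lgt0 ?invr_gt0 //.
  by case: GYin => _ /SuppP; exact.
have suppE S : Gamma_in a' b X0 S \/ Gamma_in a b' X0 S ->
    forall i j, 0 < S i j -> rho i * gam j = 1.
  case=> -[[[S0 _ _] Sr Sc] /SuppP SX].
    apply: (supp_same_marginals ha hb hX0 XY XZ GY YE S0 SX Y0 Ysupp).
      by move=> i; rewrite Sr Ya.
    by move=> j; rewrite Sc Yb.
  apply: (supp_same_marginals ha hb hX0 XY XZ GY YE S0 SX Z0 Zsupp).
    by move=> i; rewrite Sr Za.
  by move=> j; rewrite Sc Zb.
exists a', b'; split.
  move=> k i; rewrite inE mxE lE mulrAC divff ?(gt_eqF (ha i)) // mul1r.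
  by move/eqP.
split.
  move=> k j; rewrite inE mxE lE mulrAC divff ?(gt_eqF (hb j)) // mul1r.
  move=> /eqP <-.
  by rewrite invrK.
split.
  by move=> k i; rewrite inE lE => /eqP <-; exact: cvg_rho.
split.
  move=> k j; rewrite inE lE => /eqP <-; rewrite invrK; exact: cvg_gam.
split.
  (* Here [rho i * gam j = l k / l k'], which is less than 1. *)
  move=> k k' i j kk'; rewrite !inE => /eqP ri /eqP gj n; apply: ipfp_eq0 => //.
  rewrite leNgt; apply/negP => /ge1; rewrite leNgt => /negP; apply.
  by rewrite -[gam j]invrK ri gj ltr_pdivrMr ?mul1r ?l_mono // l0.
split.
  move=> k k' i j kk'; rewrite !inE => /eqP ri /eqP gj.
  have ne1 : rho i * gam j != 1.
    rewrite -[gam j]invrK ri gj gt_eqF // ltr_pdivlMr ?mul1r ?l_mono //.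
  by split=> [|X0p]; [exact: ipfp_cvg0|exact: ipfp_cvg_geometrically].
split.
  exists Y; split; last exact: cvg_mx.
  apply: (scaled_limit_unique_minimizer (Z := fun n => X n.*2)) => // [n|n|].
  + exact: ipfp_scaled.
  + exact: ipfp_total.
  + by under eq_bigr do rewrite -Ya; rewrite -/(total_sum Y) total_sum_col -hb1;
       apply: eq_bigr.
split.
  exists Z; split; last exact: cvg_mx.
  apply: (scaled_limit_unique_minimizer (Z := fun n => X n.*2.+1)) => // [n|n].
  + exact: ipfp_scaled.
  + exact: ipfp_total.
split; first split.
  by move=> k; rewrite b'E -mass a'E mulKf // gt_eqF.
  move=> S GS; apply/fintype.subsetP => -[i j]; rewrite inE /=.
  move=> /(suppE S GS)/gamV e; have [k rk] := rhol i.
  by apply/finset.bigcupP; exists k; rewrite // !inE /= e rk eqxx.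
move=> D1 D2; split.
  move=> S GS; have e i j : S i j * rho i = S i j * (gam j)^-1.
    have [[[S0 _ _] _ _] _] := GS.
    have [/(suppE S (or_intror GS))/gamV -> //|Sn] := ltP 0 (S i j).
    have -> : S i j = 0 by apply/eqP; rewrite eq_le Sn S0.
    by rewrite !mul0r.
  have D1E : D1 *m S = \matrix_(i, j) (S i j * rho i).
    apply/matrixP => i j; rewrite mul_diag_mx !mxE [_ * rho i]mulrC mulfK ?gt_eqF //.
    by rewrite mulrC.
  rewrite D1E; split.
    apply/matrixP => i j; rewrite mul_mx_diag !mxE e; congr (_ * _).
    by rewrite [in RHS]invfM mulVKf // gt_eqF.
  apply: (Gamma_in_rescale (v := fun j => (gam j)^-1)) GS => // [j|i|j].
  + by rewrite invr_gt0.
  + by rewrite mxE.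
  + by rewrite mxE mulfK // gt_eqF.
  move=> T GT; have e i j : T i j * (rho i)^-1 = T i j * gam j.
    have [[[T0 _ _] _ _] _] := GT.
    have [/(suppE T (or_introl GT))/gamV <-|Tn] := ltP 0 (T i j).
      by rewrite invrK.
    have -> : T i j = 0 by apply/eqP; rewrite eq_le Tn T0.
    by rewrite !mul0r.
  exists (\matrix_(i, j) (T i j * (rho i)^-1)); split.
    apply: (Gamma_in_rescale (v := gam)) GT => // [i|i|j].
    + by rewrite invr_gt0.
    + by rewrite mxE mulfK // gt_eqF.
    + by rewrite mxE.
  apply/matrixP => i j; rewrite mul_diag_mx !mxE.
  by field; rewrite !gt_eqF.
Qed.
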